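(* Let $N$ be a staircase Kunz nilsemigroup with exactly three atoms $p_1,p_2,p_3\in\mathbb Z_m$, and let $z\ne z'$ be outer Betti elements of $N$ with $\mathrm{supp}(z)=\mathrm{supp}(z')=\{1,2\}$. Then $z$ or $z'$ is redundant.
   Context: Kunz cone $\mathcal C_m\subseteq\mathbb R^{m-1}$ (coordinates indexed by nonzero residues of $\mathbb Z_m$, $x_0=0$): defined by $x_i+x_j\ge x_{i+j}$ for nonzero $i,j$ with $i+j\ne0$. A face with trivial Kunz subgroup (no $x_i$, $i\ne0$, vanishing identically on it) has Kunz nilsemigroup $\mathbb Z_m\cup\{\infty\}$ with nil element $\infty$ and $a\oplus b=a+b$ if $x_a+x_b=x_{a+b}$ on the whole face, $\infty$ otherwise; a Kunz nilsemigroup means one arising this way. Atoms: nonzero elements not a sum of two nonzero ones. $\mathsf Z_N(n)=\{z\in\mathbb Z^3_{\ge0}: z_1p_1\oplus z_2p_2\oplus z_3p_3=n\}$, $\bar z=z_1p_1+z_2p_2+z_3p_3$ in $\mathbb Z_m$, $\mathrm{supp}(z)=\{i:z_i>0\}$. $N$ is staircase if every non-nil element has exactly one factorization; then an outer Betti element is a vector $b\in\mathsf Z_N(\infty)$ such that for each $i\in\mathrm{supp}(b)$, $b-e_i$ is a factorization of a non-nil element. Its Betti inequality is $b\cdot x\ge a\cdot x$ where $\mathsf Z_N(\bar b)=\{a\}$. $F_N\subseteq\mathbb R^3$ is the cone of points satisfying all Betti inequalities. An outer Betti element is redundant if its Betti inequality does not define a facet of $F_N$. *)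

(* Defs.v *)
From HB Require Import structures.
From mathcomp Require Import all_boot all_order all_algebra.
From mathcomp Require Import boolp classical_sets reals.

Set Implicit Arguments.
Unset Strict Implicit.
Unset Printing Implicit Defensive.

Import Order.TTheory GRing.Theory Num.Theory.

Local Open Scope ring_scope.

(* Faces of a convex cone [C] (so that all supporting hyperplanes pass through
   the origin); the zero functional makes [C] a face of itself. *)
Definition face (R : realType) (V : lmodType R) (C F : set V) : Prop :=
  exists f : {scalar V},
    (forall x, C x -> 0 <= f x) /\ F = [set x | C x /\ f x = 0]%classic.

(* [U] is the smallest subspace containing [C]. *)
Definition linear_span (R : realType) (V : vectType R) (C : set V)
    (U : {vspace V}) : Prop :=
  forall W : {vspace V}, (U <= W)%VS <-> (forall x, C x -> x \in W).

Definition cone_dim (R : realType) (V : vectType R) (C : set V) (d : nat) :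
    Prop :=
  exists U : {vspace V}, linear_span C U /\ \dim U = d.

Definition facet (R : realType) (V : vectType R) (C F : set V) : Prop :=
  face C F /\ exists d : nat, cone_dim F d /\ cone_dim C d.+1.

Definition nonzero_residue (m : nat) := {i : 'Z_m | i != 0}.

(* The ambient space R^(m-1) of the Kunz cone. *)
Definition kunz_space (R : realType) (m : nat) : lmodType R :=
  {ffun nonzero_residue m -> R^o}.

(* The coordinate x_i, with the convention x_0 = 0. *)
Definition kcoord (R : realType) (m : nat) (x : kunz_space R m) (i : 'Z_m) : R :=
  if insub i is Some u then (x : {ffun nonzero_residue m -> R^o}) u else 0.

Definition kunz_cone (R : realType) (m : nat) : set (kunz_space R m) :=
  [set x | forall i j : 'Z_m, i != 0 -> j != 0 -> i + j != 0 ->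
     kcoord x (i + j) <= kcoord x i + kcoord x j]%classic.

Definition trivial_kunz_subgroup (R : realType) (m : nat)
    (F : set (kunz_space R m)) : Prop :=
  forall i : 'Z_m, i != 0 -> ~ (forall x, F x -> kcoord x i = 0).

(* Binary operations on Z_m together with a nil element, encoded as [None]. *)
Definition nil_op (m : nat) := option 'Z_m -> option 'Z_m -> option 'Z_m.

Definition kunz_op (R : realType) (m : nat) (F : set (kunz_space R m)) :
    nil_op m :=
  fun a b =>
    match a, b with
    | Some i, Some j =>
        if `[< forall x, F x -> kcoord x i + kcoord x j = kcoord x (i + j) >]
        then Some (i + j) else None
    | _, _ => None
    end.

Definition kunz_nilsemigroup (R : realType) (m : nat) (N : nil_op m) : Prop :=
  exists F : set (kunz_space R m),
    [/\ face (@kunz_cone R m) F, trivial_kunz_subgroup F & N = kunz_op F].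

Definition atom (m : nat) (N : nil_op m) (a : option 'Z_m) : Prop :=
  a <> Some 0 /\
  forall b c : option 'Z_m, b <> Some 0 -> c <> Some 0 -> a <> N b c.

(* [p] lists all the atoms, without repetition; the atoms p_1, p_2, p_3 and the
   coordinates 1, 2, 3 of a vector are indexed by 0, 1, 2 in ['I_3]. *)
Definition three_atoms (m : nat) (N : nil_op m) (p : 'I_3 -> 'Z_m) : Prop :=
  injective p /\
  forall a : option 'Z_m, atom N a <-> exists i : 'I_3, a = Some (p i).

Definition expvec := {ffun 'I_3 -> nat}.

(* The big operator brackets to the right, which is immaterial as a Kunz
   nilsemigroup is associative. *)
Definition fact_sum (m : nat) (N : nil_op m) (p : 'I_3 -> 'Z_m) (z : expvec) :
    option 'Z_m :=
  \big[N/Some 0]_(i < 3) iter (z i) (N (Some (p i))) (Some 0).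

Definition factorizations (m : nat) (N : nil_op m) (p : 'I_3 -> 'Z_m)
    (n : option 'Z_m) : set expvec :=
  [set z | fact_sum N p z = n]%classic.

Definition residue (m : nat) (p : 'I_3 -> 'Z_m) (z : expvec) : 'Z_m :=
  \sum_(i < 3) p i *+ z i.

Definition supp (z : expvec) : {set 'I_3} := [set i | (0 < z i)%N]%SET.

Definition staircase (m : nat) (N : nil_op m) (p : 'I_3 -> 'Z_m) : Prop :=
  forall n : 'Z_m, exists! z : expvec, factorizations N p (Some n) z.

(* z - e_i; only meaningful for i in the support of z. *)
Definition sub_unit (z : expvec) (i : 'I_3) : expvec :=
  [ffun j => (z j - (j == i))%N].

Definition outer_betti (m : nat) (N : nil_op m) (p : 'I_3 -> 'Z_m)
    (b : expvec) : Prop :=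
  factorizations N p None b /\
  forall i : 'I_3, i \in supp b ->
    exists n : 'Z_m, factorizations N p (Some n) (sub_unit b i).

Definition dot (R : realType) (z : expvec) (x : 'rV[R]_3) : R :=
  \sum_(i < 3) (z i)%:R * x 0 i.

Definition betti_cone (R : realType) (m : nat) (N : nil_op m)
    (p : 'I_3 -> 'Z_m) : set 'rV[R]_3 :=
  [set x | forall b a : expvec, outer_betti N p b ->
     factorizations N p (Some (residue p b)) = [set a] ->
     dot a x <= dot b x]%classic.

Definition redundant (R : realType) (m : nat) (N : nil_op m)
    (p : 'I_3 -> 'Z_m) (b : expvec) : Prop :=
  forall a : expvec,
    factorizations N p (Some (residue p b)) = [set a]%classic ->
    ~ facet (@betti_cone R m N p)
        [set x | @betti_cone R m N p x /\ dot b x = dot a x]%classic.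

(* Main.v *)
(* The staircase of vectors with a non-nil sum is a transversal for the residue
   map, so [a = c e_3] and [a' = c' e_3] for the factorizations [a], [a'] of the
   residues of [z] and [z'].  If [c <= c'], the inequality of [z] is the sum of
   that of [z'] and of one that follows from the Betti inequalities; hence on the
   face cut out by [z] both inequalities are tight.  They are independent because
   [z] and [z'] are incomparable, so this face has dimension at most 1, whereas
   the cone is full-dimensional: a point of the Kunz face realizing [N] satisfies
   all the Betti inequalities strictly. *)
Require Import Defs.
From mathcomp Require Import all_boot all_order all_algebra.
From mathcomp Require Import boolp classical_sets reals.
From mathcomp Require Import ring lra zify.

Set Implicit Arguments.
Unset Strict Implicit.
Unset Printing Implicit Defensive.

Import Order.TTheory GRing.Theory Num.Theory.

Local Open Scope ring_scope.

(** * Coordinates and subadditivity on the Kunz cone *)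

Lemma kcoord0 (R : realType) (m : nat) (x : kunz_space R m) : kcoord x 0 = 0.
Proof. by rewrite /kcoord insubF // eqxx. Qed.

Lemma kcoordD (R : realType) (m : nat) (x y : kunz_space R m) (i : 'Z_m) :
  kcoord (x + y) i = kcoord x i + kcoord y i.
Proof. by rewrite /kcoord; case: insubP => [u _ _|_]; rewrite ?ffunE ?addr0. Qed.

Lemma kcoord_zero (R : realType) (m : nat) (i : 'Z_m) :
  kcoord (0 : kunz_space R m) i = 0.
Proof. by rewrite /kcoord; case: insubP => [u _ _|_]; rewrite ?ffunE. Qed.

Lemma kcoord_sum (R : realType) (m : nat) (T : finType)
    (y : T -> kunz_space R m) (i : 'Z_m) :
  kcoord (\sum_t y t) i = \sum_t kcoord (y t) i.
Proof.
apply: (big_morph (fun x => kcoord x i)) => [x y'|]; first exact: kcoordD.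
exact: kcoord_zero.
Qed.

(* If [x_i < 0] then translation by [i] decreases the coordinates, so the
   minimal coordinate can only be at [- i]; applied twice this gives
   [i + i = 0], and a third residue [l] yields [2 x_i >= 0]. *)
Lemma kunz_cone_ge0 (R : realType) (m : nat) (x : kunz_space R m) (i : 'Z_m) :
  (2 < #|'Z_m|)%N -> kunz_cone x -> 0 <= kcoord x i.
Proof.
move=> card3 Cx; have [->|i0] := eqVneq i 0; first by rewrite kcoord0.
rewrite leNgt; apply/negP => xi_lt0.
case: (@arg_minP _ _ _ i [pred j : 'Z_m | j != 0] (kcoord x) i0) => j /= j0 minj.
have negE (k : 'Z_m) : k != 0 -> kcoord x k < 0 -> k + j = 0.
  move=> k0 xk_lt0; apply/eqP/negPn/negP => kj0.
  by have := minj _ kj0; have := Cx _ _ k0 j0 kj0; lra.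
have ij0 := negE _ i0 xi_lt0.
have jj0 : j + j = 0 by apply: negE => //; apply: le_lt_trans xi_lt0; apply: minj.
have ii0 : i + i = 0 by rewrite -[RHS]ij0; congr (_ + _); apply: (addIr j); rewrite ij0.
have /card_gt0P[l] : (0 < #|[set~ 0%R] :\ i|)%N.
  have := cardsD1 i [set~ (0 : 'Z_m)%R]; rewrite !inE i0 cardsC1 => E.
  by move: card3; case: #|'Z_m| E => [//|n] /= -> ; rewrite add1n !ltnS.
rewrite !inE => /andP[li l0].
have il0 : i + l != 0.
  by apply: contra li => /eqP il0; rewrite -(inj_eq (addrI i)) il0 ii0.
have iil : i + (i + l) = l by rewrite addrA ii0 add0r.
have := Cx _ _ i0 l0 il0; have := Cx _ _ i0 il0; rewrite iil => /(_ l0); lra.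
Qed.

Lemma kunz_cone_subadd (R : realType) (m : nat) (x : kunz_space R m)
    (i j : 'Z_m) :
  (2 < #|'Z_m|)%N -> kunz_cone x -> kcoord x (i + j) <= kcoord x i + kcoord x j.
Proof.
move=> card3 Cx.
have [->|i0] := eqVneq i 0; first by rewrite kcoord0 !add0r.
have [->|j0] := eqVneq j 0; first by rewrite kcoord0 !addr0.
have [->|ij0] := eqVneq (i + j) 0; last exact: Cx.
by rewrite kcoord0 addr_ge0 // kunz_cone_ge0.
Qed.

(** * Nilsemigroups read off from one point *)

(** Tightness on a whole face becomes one equation at a single point [W]. *)
Definition weight_op (R : realType) (m : nat) (W : 'Z_m -> R) : nil_op m :=
  fun a b =>
    match a, b with
    | Some i, Some j => if W i + W j == W (i + j) then Some (i + j) else None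
    | _, _ => None
    end.

Definition kunz_weight (R : realType) (m : nat) (W : 'Z_m -> R) : Prop :=
  [/\ W 0 = 0, forall i, 0 <= W i & forall i j, W (i + j) <= W i + W j].

(* [W] is a point in the relative interior of the face, obtained by summing
   witnesses of all the Kunz inequalities which are not tight on the face. *)
Lemma kunz_nilsemigroup_weight (R : realType) (m : nat) (N : nil_op m) :
  (2 < #|'Z_m|)%N -> kunz_nilsemigroup R N ->
  exists2 W : 'Z_m -> R, kunz_weight W & N = weight_op W.
Proof.
move=> card3 [F [[f [_ FE]] _ ->]].
have F0 : F 0.
  rewrite FE; split; last by rewrite raddf0.
  by move=> i j _ _ _; rewrite !kcoord_zero addr0.
have FD x y : F x -> F y -> F (x + y).
  rewrite FE => -[Cx fx] [Cy fy]; split; last by rewrite raddfD /= fx fy addr0.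
  move=> i j i0 j0 ij0; rewrite !kcoordD addrACA.
  by apply: lerD; [exact: Cx | exact: Cy].
have FC x : F x -> kunz_cone x by rewrite FE => -[].
pose slack x (t : 'Z_m * 'Z_m) : R :=
  kcoord x t.1 + kcoord x t.2 - kcoord x (t.1 + t.2).
(* For an inequality tight on all of [F] the default witness is 0, a point of [F]. *)
have /boolp.choice[y yP] t : exists y : kunz_space R m, F y /\
    ((exists2 x, F x & slack x t != 0) -> slack y t != 0).
  have [[x Fx xt]|no] := pselect (exists2 x, F x & slack x t != 0).
    by exists x.
  by exists 0; split.
have FX : F (\sum_t y t).
  by apply: (big_ind F) => // t _; case: (yP t).
have slack_ge0 x t : F x -> 0 <= slack x t.
  by move=> Fx; rewrite subr_ge0 kunz_cone_subadd //; exact: FC.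
have slack_sum t : slack (\sum_t y t) t = \sum_s slack (y s) t.
  by rewrite /slack !kcoord_sum sumrB big_split.
exists (kcoord (\sum_t y t)).
  split=> [|i|i j]; first exact: kcoord0.
    by apply: kunz_cone_ge0 => //; exact: FC.
  by apply: kunz_cone_subadd => //; exact: FC.
apply/funext => -[i|] //; apply/funext => -[j|] //=.
suff -> : `[< forall x, F x -> kcoord x i + kcoord x j = kcoord x (i + j) >] =
          (kcoord (\sum_t y t) i + kcoord (\sum_t y t) j ==
           kcoord (\sum_t y t) (i + j)) by [].
apply/asboolP/eqP => [|eqX x Fx]; first exact.
apply/eqP; rewrite -subr_eq0; apply/negPn/negP => xij.
have : slack (y (i, j)) (i, j) != 0 by apply: (yP (i, j)).2; exists x.
have/eqP := slack_sum (i, j); rewrite [slack _ _]/slack /= eqX subrr eq_sym.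
rewrite psumr_eq0 => [/allP/(_ (i, j))|s _]; last by apply: slack_ge0; case: (yP s).
by rewrite mem_index_enum => /(_ isT)/= ->.
Qed.

(** * Arithmetic of exponent vectors *)

Definition unit_vec (k : 'I_3) : expvec := [ffun i => (i == k : nat)].

(** Subtraction is truncated, so this is the positive part of [z - z']. *)
Definition vec_sub (z z' : expvec) : expvec := [ffun i => (z i - z' i)%N].

Lemma expvecP (z z' : expvec) : (forall i : 'I_3, z i = z' i) -> z = z'.
Proof. by move=> zz'; apply/ffunP. Qed.

Lemma expvecD (z z' : expvec) (i : 'I_3) : (z + z' : expvec) i = (z i + z' i)%N.
Proof. by rewrite ffunE. Qed.

Lemma vec_subK (z z' : expvec) :
  (forall i, z' i <= z i)%N -> z = z' + vec_sub z z'.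
Proof. by move=> le; apply: expvecP => i; rewrite expvecD ffunE subnKC. Qed.

Lemma sub_unitK (z : expvec) (k : 'I_3) :
  (0 < z k)%N -> z = unit_vec k + sub_unit z k.
Proof.
move=> zk; apply: expvecP => i; rewrite expvecD !ffunE.
by have [->|] := eqVneq i k; rewrite ?subnKC // subn0.
Qed.

Lemma sum_sub_unit (z : expvec) (k : 'I_3) :
  (0 < z k)%N -> (\sum_i z i = (\sum_i sub_unit z k i).+1)%N.
Proof.
move=> zk; rewrite [in LHS](sub_unitK zk).
under eq_bigr do rewrite expvecD.
rewrite big_split -[RHS]add1n; congr (_ + _)%N.
rewrite (bigD1 k) //= big1 => [|i ik]; rewrite ffunE ?eqxx //.
by rewrite (negPf ik).
Qed.

Lemma expvec_ind (P : expvec -> Prop) :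
  P 0 -> (forall k z, P z -> P (unit_vec k + z)) -> forall z, P z.
Proof.
move=> P0 PS z; have [n] := ubnP (\sum_i z i)%N; elim: n z => // n IH z zn.
have [k zk|z0] := pickP (fun k => 0 < z k)%N.
  by rewrite (sub_unitK zk); apply/PS/IH; rewrite -ltnS -sum_sub_unit.
suff -> : z = 0 by [].
by apply: expvecP => i; rewrite ffunE; apply/eqP; have := z0 i; rewrite lt0n => /negbFE.
Qed.

Lemma dotD (R : realType) (z z' : expvec) (x : 'rV[R]_3) :
  dot (z + z') x = dot z x + dot z' x.
Proof.
rewrite /dot -big_split; apply: eq_bigr => i _.
by rewrite expvecD natrD mulrDl.
Qed.

Lemma dot0 (R : realType) (x : 'rV[R]_3) : dot 0 x = 0.
Proof. by rewrite /dot big1 // => i _; rewrite ffunE mul0r. Qed.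

Lemma dot_unit (R : realType) (k : 'I_3) (x : 'rV[R]_3) :
  dot (unit_vec k) x = x 0 k.
Proof.
rewrite /dot (bigD1 k) //= big1 => [|i ik]; rewrite ffunE ?eqxx ?mul1r ?addr0 //.
by rewrite (negPf ik) mul0r.
Qed.

Lemma dotDr (R : realType) (z : expvec) (x y : 'rV[R]_3) (a : R) :
  dot z (x + a *: y) = dot z x + a * dot z y.
Proof.
rewrite /dot mulr_sumr -big_split; apply: eq_bigr => i _ /=.
by rewrite !mxE mulrDr mulrCA.
Qed.

Lemma residueD (m : nat) (p : 'I_3 -> 'Z_m) (z z' : expvec) :
  residue p (z + z') = residue p z + residue p z'.
Proof.
rewrite /residue -big_split; apply: eq_bigr => i _.
by rewrite expvecD mulrnDr.
Qed.

Lemma residue0 (m : nat) (p : 'I_3 -> 'Z_m) : residue p 0 = 0.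
Proof. by rewrite /residue big1 // => i _; rewrite ffunE. Qed.

Lemma residue_unit (m : nat) (p : 'I_3 -> 'Z_m) (k : 'I_3) :
  residue p (unit_vec k) = p k.
Proof.
rewrite /residue (bigD1 k) //= big1 => [|i ik]; rewrite ffunE ?eqxx ?addr0 //.
by rewrite (negPf ik).
Qed.

(** * Reduced vectors: those with a non-nil sum *)

Definition atom_weights (R : realType) (m : nat) (W : 'Z_m -> R)
  (p : 'I_3 -> 'Z_m) : 'rV[R]_3 := \row_i W (p i).

Definition reduced (R : realType) (m : nat) (W : 'Z_m -> R)
    (p : 'I_3 -> 'Z_m) (z : expvec) : bool :=
  dot z (atom_weights W p) == W (residue p z).

Lemma weight_residue_le (R : realType) (m : nat) (W : 'Z_m -> R)
    (p : 'I_3 -> 'Z_m) (z : expvec) :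
  kunz_weight W -> W (residue p z) <= dot z (atom_weights W p).
Proof.
case=> W0 _ WD; elim/expvec_ind: z => [|k z IH]; first by rewrite dot0 residue0 W0.
rewrite dotD residueD dot_unit residue_unit mxE.
by apply: le_trans (WD _ _) _; rewrite lerD2l.
Qed.

(* Both components of [(i, t)], a residue and an upper bound [t] of its weight,
   are additive, and [weight_op] acts on pairs; [None] records a strict bound. *)
Lemma weight_op_tight (R : realType) (m : nat) (W : 'Z_m -> R)
    (i j : 'Z_m) (t u : R) :
  kunz_weight W -> W i <= t -> W j <= u ->
  weight_op W (if t == W i then Some i else None)
              (if u == W j then Some j else None) =
  (if t + u == W (i + j) then Some (i + j) else None).
Proof.
case=> _ _ WD it ju; have ij := WD i j.
case: (eqVneq t (W i)) => [->|ti].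
  case: (eqVneq u (W j)) => [->|uj] //=.
  by rewrite [RHS]ifF //; apply/negbTE/negP => /eqP; move/eqP: uj; lra.
by rewrite [RHS]ifF //; apply/negbTE/negP => /eqP; move/eqP: ti; lra.
Qed.

Lemma fact_sum_weight (R : realType) (m : nat) (W : 'Z_m -> R)
    (p : 'I_3 -> 'Z_m) (z : expvec) :
  kunz_weight W ->
  fact_sum (weight_op W) p z = if reduced W p z then Some (residue p z) else None.
Proof.
move=> hW; have [W0 _ WD] := hW.
(* Here [o] is a partial sum, [i] the residue and [t] the atom weight collected so far; [o] is nil
   once [t] exceeds [W i]. *)
pose K o (i : 'Z_m) (t : R) :=
  W i <= t /\ o = if t == W i then Some i else None.
have K0 : K (Some 0) 0 0 by rewrite /K W0 eqxx.
have KD o i t o' j u :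
    K o i t -> K o' j u -> K (weight_op W o o') (i + j) (t + u).
  move=> [it ->] [ju ->]; split; last exact: weight_op_tight.
  by apply: le_trans (WD i j) _; apply: lerD.
suff [] : K (fact_sum (weight_op W) p z) (residue p z) (dot z (atom_weights W p)) by [].
apply: (big_rec3 K) => // k o i t _; apply: (KD).
elim: (z k) => [|n IH]; first by rewrite mulr0n mul0r.
rewrite iterS -nat1r mulrDl mul1r [p k *+ _]mulrS; apply: (KD) IH.
by rewrite mxE; split=> //; rewrite eqxx.
Qed.

(** The upper bounds for [z] and [z'] add up to an attained bound, so each is attained. Hence
    reduced vectors form a down-set. *)
Lemma reduced_addl (R : realType) (m : nat) (W : 'Z_m -> R)
    (p : 'I_3 -> 'Z_m) (z z' : expvec) :
  kunz_weight W -> reduced W p (z + z') -> reduced W p z.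
Proof.
move=> hW; have [_ _ WD] := hW; rewrite /reduced dotD residueD => /eqP E.
have := weight_residue_le p z hW; have := weight_residue_le p z' hW.
have := WD (residue p z) (residue p z'); rewrite -E => h1 h2 h3.
by apply/eqP; lra.
Qed.

Lemma reduced_le (R : realType) (m : nat) (W : 'Z_m -> R)
    (p : 'I_3 -> 'Z_m) (z z' : expvec) :
  kunz_weight W -> (forall i, z i <= z' i)%N -> reduced W p z' -> reduced W p z.
Proof. by move=> hW /vec_subK ->; apply: reduced_addl. Qed.

Lemma reduced0 (R : realType) (m : nat) (W : 'Z_m -> R) (p : 'I_3 -> 'Z_m) :
  kunz_weight W -> reduced W p 0.
Proof. by case=> W0 _ _; rewrite /reduced dot0 residue0 W0. Qed.

Lemma factorizations_weight (R : realType) (m : nat) (W : 'Z_m -> R)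
    (p : 'I_3 -> 'Z_m) (n : 'Z_m) (z : expvec) :
  kunz_weight W ->
  factorizations (weight_op W) p (Some n) z <->
  reduced W p z /\ residue p z = n.
Proof.
move=> hW; rewrite /factorizations /mkset fact_sum_weight //.
by case: ifP => _; split=> [[]|[]] // _ ->.
Qed.

Lemma outer_betti_weight (R : realType) (m : nat) (W : 'Z_m -> R)
    (p : 'I_3 -> 'Z_m) (b : expvec) :
  kunz_weight W ->
  outer_betti (weight_op W) p b <->
  ~~ reduced W p b /\ forall i, (0 < b i)%N -> reduced W p (sub_unit b i).
Proof.
move=> hW; rewrite /outer_betti {1}/factorizations /mkset fact_sum_weight //.
split=> -[bN bS]; split.
- by case: (reduced _ _ _) bN.
- move=> i bi; have [|n] := bS i; first by rewrite inE.
  by move/factorizations_weight => /(_ hW)[].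
- by rewrite (negPf bN).
- move=> i; rewrite inE => /bS bi; exists (residue p (sub_unit b i)).
  by apply/factorizations_weight.
Qed.

(** * Factorizations and Betti inequalities *)

(** One implication is existence of the factorization of [n], the other its uniqueness. *)
Definition is_factorization_map (R : realType) (m : nat) (W : 'Z_m -> R)
    (p : 'I_3 -> 'Z_m) (fac : 'Z_m -> expvec) : Prop :=
  forall n z, (reduced W p z /\ residue p z = n) <-> z = fac n.

Lemma staircase_factorization_map (R : realType) (m : nat) (W : 'Z_m -> R)
    (p : 'I_3 -> 'Z_m) :
  kunz_weight W -> staircase (weight_op W) p ->
  exists fac, is_factorization_map W p fac.
Proof.
move=> hW /boolp.choice[fac facP]; exists fac => n z.
rewrite -factorizations_weight //; have [fn uniq] := facP n.
by split=> [/uniq|->].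
Qed.

Lemma betti_cone_weight (R : realType) (m : nat) (W : 'Z_m -> R)
    (p : 'I_3 -> 'Z_m) (fac : 'Z_m -> expvec) (x : 'rV[R]_3) :
  kunz_weight W -> is_factorization_map W p fac ->
  betti_cone (weight_op W) p x <->
  forall b, outer_betti (weight_op W) p b -> dot (fac (residue p b)) x <= dot b x.
Proof.
move=> hW facP; split=> [Cx b ob|Cx b a ob E].
  apply: Cx => //; apply/seteqP; split=> z.
    by move/(factorizations_weight _ _ _ hW)/facP.
  by move=> ->; apply/(factorizations_weight _ _ _ hW)/facP.
have /(factorizations_weight _ _ _ hW)/facP -> :
  factorizations (weight_op W) p (Some (residue p b)) a by rewrite E.
exact: Cx.
Qed.

(** Units are removed while the vector stays non-reduced; what remains at the end is outer Betti. *)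
Lemma exists_outer_betti (R : realType) (m : nat) (W : 'Z_m -> R)
    (p : 'I_3 -> 'Z_m) (b : expvec) :
  kunz_weight W -> ~~ reduced W p b ->
  exists b' c : expvec, outer_betti (weight_op W) p b' /\ b = b' + c.
Proof.
move=> hW; have [n] := ubnP (\sum_i b i)%N; elim: n b => // n IH b bn bN.
have [k /andP[bk bkN]|minb] := pickP (fun k => (0 < b k)%N && ~~ reduced W p (sub_unit b k)).
  have [|b' [c [ob E]]] := IH (sub_unit b k) _ bkN.
    by rewrite -ltnS -sum_sub_unit.
  by exists b', (unit_vec k + c); split; rewrite // addrCA -E -sub_unitK.
exists b, 0; split; last by rewrite addr0.
apply/outer_betti_weight => //; split=> // i bi.
by have := minb i; rewrite bi => /negbFE.
Qed.

(** The order of [R] is not well-founded, but the number of elements of smaller value decreases. *)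
Lemma finite_weight_ind (R : realType) (T : finType) (f : T -> R)
    (P : T -> Prop) :
  (forall t, (forall s, f s < f t -> P s) -> P t) -> forall t, P t.
Proof.
move=> H t; have [n] := ubnP #|[set s | f s < f t]%SET|; elim: n t => // n IH t tn.
apply: H => s st; apply: IH; rewrite -ltnS; apply: leq_trans tn.
rewrite ltnS; apply: proper_card.
apply/properP; split; last by exists s; rewrite !inE ?ltxx.
by apply/fintype.subsetP => r; rewrite !inE => /lt_trans; apply.
Qed.

(* Every linear inequality coming from a pair of factorizations follows from
   the Betti inequalities: first for [fac n + e_k], by well-founded induction
   on its weight (a Betti move strictly lowers the weight), then for all [c]. *)
Lemma betti_cone_factorization (R : realType) (m : nat) (W : 'Z_m -> R)
    (p : 'I_3 -> 'Z_m) (fac : 'Z_m -> expvec) (x : 'rV[R]_3) (c : expvec) :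
  kunz_weight W -> is_factorization_map W p fac ->
  betti_cone (weight_op W) p x -> dot (fac (residue p c)) x <= dot c x.
Proof.
move=> hW facP /(betti_cone_weight _ hW facP) Cx; have [W0 Wge0 WD] := hW.
set w := atom_weights W p; pose V n := dot (fac n) x.
pose Q n k := V (n + p k) <= V n + x 0 k.
have facK z : reduced W p z -> fac (residue p z) = z.
  by move=> zS; apply/esym/facP.
have facR n : reduced W p (fac n) /\ residue p (fac n) = n by apply/facP.
(* The atoms of [a] are added one by one; by subadditivity every pair met on the way has weight
   below [T]. *)
have extend T r a : (forall n k, W n + W (p k) < T -> Q n k) ->
    W r + dot a w < T -> V (r + residue p a) <= V r + dot a x.
  move=> QT; elim/expvec_ind: a => [|k a IH]; first by rewrite residue0 !dot0 !addr0.
  rewrite !dotD residueD residue_unit !dot_unit mxE => lt.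
  have Wk := Wge0 (p k); have {}IH := IH ltac:(lra).
  have : Q (r + residue p a) k.
    apply: QT; have := WD r (residue p a); have := weight_residue_le p a hW.
    by rewrite -/w; lra.
  by rewrite /Q [p k + _]addrC addrA; lra.
have QP n k : Q n k.
  pose f (t : 'Z_m * 'I_3) := W t.1 + W (p t.2).
  suff /(_ (n, k)) : forall t, Q t.1 t.2 by [].
  apply: (@finite_weight_ind _ _ f) => -[{}n {}k] /= IH.
  have {}IH n' k' : W n' + W (p k') < W n + W (p k) -> Q n' k' := IH (n', k').
  have [nS nE] := facR n; set s := fac n in nS nE.
  have bE : residue p (unit_vec k + s) = n + p k.
    by rewrite residueD residue_unit nE addrC.
  have [bS|bN] := boolP (reduced W p (unit_vec k + s)).
    by rewrite /Q /V -bE facK // dotD dot_unit addrC.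
  have [b [c' [ob E]]] := exists_outer_betti hW bN.
  have [bbN _] := (outer_betti_weight p b hW).1 ob.
  (* At [k] the vector [c'] vanishes, since otherwise [b] would lie below the reduced vector [s]. *)
  have cs i : (c' i <= s i)%N.
    have Ei j : (b j + c' j = (j == k) + s j)%N.
      by rewrite -!expvecD -E expvecD ffunE.
    have := Ei i; have [ik|] := eqVneq i k; last by lia.
    case: (posnP (c' i)) => [->//|ci _]; exfalso; move/negP: bbN; apply.
    apply: reduced_le nS => // j; have := Ei j; have [jk|] := eqVneq j k; last by lia.
    by rewrite jk -ik; lia.
  have cS : reduced W p c' by exact: reduced_le nS.
  set r := residue p c'; set a := fac (residue p b).
  have [aS aE] := facR (residue p b).
  have ab : dot a w < dot b w.
    move/eqP: aS; rewrite -/a -/w aE => ->.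
    by rewrite lt_neqAle weight_residue_le // andbT eq_sym.
  have Ew := congr1 (fun z => dot z w) E; have Ex := congr1 (fun z => dot z x) E.
  rewrite /= !dotD dot_unit mxE in Ew; rewrite /= !dotD dot_unit in Ex.
  move/eqP: nS; rewrite -/s -/w nE => nW; move/eqP: (cS); rewrite -/w -/r => cW.
  (* Replacing [b] by [a] in [b + c'] brings the weight below that of [(n, k)], so the induction
     hypothesis allows adding [a] to [c']. *)
  have := extend (W n + W (p k)) r a IH ltac:(lra).
  have -> : r + residue p a = n + p k by rewrite aE -bE E residueD addrC.
  have := Cx b ob; rewrite -/a /Q /V (facK c' cS); lra.
(* As [QP] is unconditional, any bound above the total weight serves. *)
have := extend (W 0 + dot c w + 1) 0 c (fun n k _ => QP n k) ltac:(lra).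
have V0 : V 0 = 0 by rewrite /V -(residue0 p) facK ?dot0 ?reduced0.
by rewrite add0r V0 add0r.
Qed.

(** * Interior of the Betti cone and facets *)

Lemma finite_perturbation (R : realType) (T : finType) (g s : T -> R) :
  exists2 e, 0 < e & forall t, 0 < g t -> 0 <= g t + e * s t.
Proof.
(* The summand 1 keeps [M] positive even if no [g t] is. *)
pose M := 1 + \sum_(t | 0 < g t) `|s t| / g t.
have term_ge0 t : 0 < g t -> 0 <= `|s t| / g t by move=> gt; rewrite divr_ge0 // ltW.
have M_gt0 : 0 < M by rewrite ltr_pwDl // sumr_ge0.
exists M^-1 => [|t gt]; first by rewrite invr_gt0.
have : `|s t| / g t <= M.
  rewrite /M (bigD1 t) //= addrCA lerDl addr_ge0 // sumr_ge0 // => i /andP[gi _].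
  exact: term_ge0.
rewrite ler_pdivrMr // -ler_pdivrMl // => le.
have := ler_norm (- (M^-1 * s t)).
by rewrite normrN normrM gtr0_norm ?invr_gt0 //; lra.
Qed.

(** An outer Betti element is not reduced, so its inequality is strict at the atom weights and
    survives a small move in any direction. *)
Lemma betti_cone_interior (R : realType) (m : nat) (W : 'Z_m -> R)
    (p : 'I_3 -> 'Z_m) (fac : 'Z_m -> expvec) (v : 'rV[R]_3) :
  kunz_weight W -> is_factorization_map W p fac ->
  exists2 e, 0 < e & betti_cone (weight_op W) p (atom_weights W p + e *: v).
Proof.
move=> hW facP; set w := atom_weights W p.
(* Every outer Betti element occurs in this finite family, which yields one [e] for all. *)
pose b (t : 'Z_m * 'I_3) := unit_vec t.2 + fac t.1.
pose gap t (y : 'rV[R]_3) := dot (b t) y - dot (fac (residue p (b t))) y.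
have [e e0 he] := finite_perturbation (gap^~ w) (gap^~ v).
exists e => //; apply/(betti_cone_weight _ hW facP) => b' /(outer_betti_weight _ _ hW)[bN bS].
have [k bk|b0] := pickP (fun k => 0 < b' k)%N; last first.
  move/negP: bN; case; suff -> : b' = 0 by exact: reduced0.
  by apply: expvecP => i; rewrite ffunE; apply/eqP; have := b0 i; rewrite lt0n => /negbFE.
pose t := (residue p (sub_unit b' k), k).
have Eb : b' = b t.
  by rewrite /b /= -((facP _ _).1 (conj (bS k bk) erefl)) -sub_unitK.
rewrite !dotDr Eb; have := he t; rewrite /gap.
have : dot (fac (residue p (b t))) w < dot (b t) w.
  have [/eqP + E] := (facP (residue p (b t)) _).2 erefl; rewrite E => ->.
  by rewrite lt_neqAle weight_residue_le // andbT eq_sym -Eb.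
by move=> lt /(_ ltac:(lra)); lra.
Qed.

Lemma not_facet_in_line (R : realType) (C F : set 'rV[R]_3) (w g : 'rV[R]_3) :
  (forall v, exists2 e, 0 < e & C (w + e *: v)) ->
  (forall x, F x -> x \in <[g]>%VS) -> ~ facet C F.
Proof.
move=> Cint Fg [_ [d [[U [UF Ud]] [U' [UC U'd]]]]].
have CU x : C x -> x \in U' by apply: (UC U').1.
(* Each [v] is a multiple of the difference of the points [w + e *: v] and [w] of [C]. *)
have full : (fullv <= U')%VS.
  apply/subvP => v _.
  have [e0 _ /CU] := Cint 0; rewrite scaler0 addr0 => wU.
  have [e e_gt0 /CU] := Cint v.
  by rewrite rpredDl // rpredZeq gt_eqF.
have := dimvS full; rewrite U'd dimvf /dim /= mul1n.
have /dimvS : (U <= <[g]>)%VS by apply/UF.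
by rewrite Ud dim_vline; case: (g != 0); lia.
Qed.

(** * Relations between outer Betti elements *)

(** If [z] were smaller at [i], it would lie below the reduced vector [z' - e_i]. *)
Lemma outer_betti_le_eq (R : realType) (m : nat) (W : 'Z_m -> R)
    (p : 'I_3 -> 'Z_m) (z z' : expvec) :
  kunz_weight W -> outer_betti (weight_op W) p z ->
  outer_betti (weight_op W) p z' -> (forall i, z i <= z' i)%N -> z = z'.
Proof.
move=> hW /(outer_betti_weight _ _ hW)[zN _] /(outer_betti_weight _ _ hW)[_ zS'] le.
apply: expvecP => i; apply/eqP; rewrite eqn_leq le leqNgt; apply/negP => lti.
move/negP: zN; apply; apply: reduced_le (zS' i (leq_ltn_trans _ lti)) => // j.
by rewrite ffunE; have := le j; have [->|_] := eqVneq j i => /=; lia.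
Qed.

(** A shared [e_i] could be cancelled, leaving two reduced vectors of equal residue; by uniqueness
    [b] would be its own factorization. *)
Lemma betti_factorization_disjoint (R : realType) (m : nat) (W : 'Z_m -> R)
    (p : 'I_3 -> 'Z_m) (fac : 'Z_m -> expvec) (b : expvec) (i : 'I_3) :
  kunz_weight W -> is_factorization_map W p fac ->
  outer_betti (weight_op W) p b -> (0 < b i)%N -> fac (residue p b) i = 0%N.
Proof.
move=> hW facP /(outer_betti_weight _ _ hW)[bN bS] bi.
have [aS aE] := (facP (residue p b) _).2 erefl; set a := fac _ in aS aE *.
apply/eqP; rewrite eqn0Ngt; apply/negP => ai.
have aS' : reduced W p (sub_unit a i).
  by apply: reduced_le aS => // j; rewrite ffunE leq_subr.
have E : residue p (sub_unit a i) = residue p (sub_unit b i).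
  apply: (addrI (p i)); rewrite -(residue_unit p i) -!residueD.
  by rewrite -!sub_unitK.
have := (facP _ _).1 (conj aS' E); rewrite -((facP _ _).1 (conj (bS i bi) erefl)) => {}E.
by move/negP: bN; apply; rewrite (sub_unitK bi) -E -sub_unitK.
Qed.

(* With [u] and [v] the positive parts of [z' - z] and [z - z'], the vector [u]
   is the factorization of the residue of [v + (a' - a)], where [a <= a'] are
   the factorizations of the residues of [z] and [z'].  The corresponding
   inequality added to that of [z'] yields that of [z]. *)
Lemma betti_inequality_tight (R : realType) (m : nat) (W : 'Z_m -> R)
    (p : 'I_3 -> 'Z_m) (fac : 'Z_m -> expvec) (z z' : expvec) (i : 'I_3)
    (x : 'rV[R]_3) :
  kunz_weight W -> is_factorization_map W p fac ->
  outer_betti (weight_op W) p z -> outer_betti (weight_op W) p z' ->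
  (0 < z i)%N -> (0 < z' i)%N ->
  (forall j, fac (residue p z) j <= fac (residue p z') j)%N ->
  betti_cone (weight_op W) p x ->
  dot z x = dot (fac (residue p z)) x -> dot z' x = dot (fac (residue p z')) x.
Proof.
move=> hW facP oz oz' zi zi' le Cx tight.
have [_ zS'] := (outer_betti_weight p z' hW).1 oz'.
set u := vec_sub z' z; set v := vec_sub z z'.
(* Since [z i] is positive, [u] lies below the reduced vector [z' - e_i]. *)
have uS : reduced W p u.
  apply: reduced_le (zS' i zi') => // j; rewrite !ffunE.
  by have [->|_] := eqVneq j i => /=; lia.
(* Both sides are the coordinatewise maximum of [z] and [z']. *)
have exch : z + u = z' + v by apply: expvecP => j; rewrite !expvecD !ffunE; lia.
have [_ aE] := (facP (residue p z) _).2 erefl.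
have [_ aE'] := (facP (residue p z') _).2 erefl.
have := vec_subK le; set d := vec_sub _ _ => dE.
have resE : residue p u = residue p (v + d).
  apply: (addrI (residue p z)); rewrite -residueD exch residueD -aE' dE !residueD aE.
  by rewrite -addrA [residue p d + _]addrC.
have := betti_cone_factorization (v + d) hW facP Cx.
rewrite -resE -((facP _ _).1 (conj uS erefl)).
have := (betti_cone_weight x hW facP).1 Cx _ oz'.
have := congr1 (fun y => dot y x) exch; have := congr1 (fun y => dot y x) dE.
by rewrite /= !dotD tight; lra.
Qed.

(** * Redundancy for support on the first two atoms *)

Lemma dot3 (R : realType) (z : expvec) (x : 'rV[R]_3) :
  dot z x = (z (inord 0))%:R * x 0 (inord 0) + (z (inord 1))%:R * x 0 (inord 1)
          + (z (inord 2))%:R * x 0 (inord 2).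
Proof.
rewrite /dot !big_ord_recr big_ord0 /= add0r.
by congr (_%:R * _ + _%:R * _ + _%:R * _); congr (_ _); apply/val_inj;
  rewrite /= inordK.
Qed.

Lemma redundant_of_factorization_le (R : realType) (m : nat) (W : 'Z_m -> R)
    (p : 'I_3 -> 'Z_m) (fac : 'Z_m -> expvec) (z z' : expvec) :
  kunz_weight W -> is_factorization_map W p fac -> z <> z' ->
  outer_betti (weight_op W) p z -> outer_betti (weight_op W) p z' ->
  supp z = [set inord 0; inord 1]%SET -> supp z' = [set inord 0; inord 1]%SET ->
  (fac (residue p z) (inord 2) <= fac (residue p z') (inord 2))%N ->
  redundant R (weight_op W) p z.
Proof.
move=> hW facP zz' oz oz' sz sz' le a aE.
have {aE} -> : a = fac (residue p z).
  by apply/facP/(factorizations_weight _ _ _ hW); rewrite aE.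
have ordE (i : 'I_3) : [\/ i = inord 0, i = inord 1 | i = inord 2].
  by case: i => -[|[|[|]]] // i; [constructor 1|constructor 2|constructor 3];
    apply/val_inj; rewrite /= inordK.
have pos b : supp b = [set inord 0; inord 1]%SET ->
    [/\ 0 < b (inord 0), 0 < b (inord 1) & b (inord 2) = 0]%N.
  move=> /finset.setP sb; have := sb (inord 0); have := sb (inord 1); have := sb (inord 2).
  rewrite !inE !eqxx orbT -!val_eqE /= !inordK //= => /negbT b2 -> ->.
  by split=> //; apply/eqP; rewrite eqn0Ngt.
have [z0 z1 z2] := pos _ sz; have [z0' z1' z2'] := pos _ sz'.
have disj := betti_factorization_disjoint hW facP.
have a0 := disj _ _ oz z0; have a1 := disj _ _ oz z1.
have a0' := disj _ _ oz' z0'; have a1' := disj _ _ oz' z1'.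
(* Proportional first two coordinates would make [z] and [z'] comparable. *)
have D_neq0 : (z (inord 0))%:R * (z' (inord 1))%:R
            - (z (inord 1))%:R * (z' (inord 0))%:R != 0 :> R.
  rewrite subr_eq0 -!natrM eqr_nat; apply/negP => /eqP D.
  have [zz|zz] : (z (inord 0) <= z' (inord 0) /\ z (inord 1) <= z' (inord 1)
    \/ z' (inord 0) <= z (inord 0) /\ z' (inord 1) <= z (inord 1))%N by nia.
    apply: zz'; apply: outer_betti_le_eq hW oz oz' _ => i.
    by have [->|->|->] := ordE i; rewrite ?z2 ?z2'; lia.
  apply/zz'/esym; apply: outer_betti_le_eq hW oz' oz _ => i.
  by have [->|->|->] := ordE i; rewrite ?z2 ?z2'; lia.
set c := fac (residue p z) (inord 2) in le; set c' := fac (residue p z') (inord 2) in le.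
(* The cross product of the normals [z - c e_3] and [z' - c' e_3] of the two tight equations. *)
pose g : 'rV[R]_3 := \row_i nth 0
  [:: c%:R * (z' (inord 1))%:R - c'%:R * (z (inord 1))%:R;
      (z (inord 0))%:R * c'%:R - (z' (inord 0))%:R * c%:R;
      (z (inord 0))%:R * (z' (inord 1))%:R - (z (inord 1))%:R * (z' (inord 0))%:R] i.
apply: (not_facet_in_line (w := atom_weights W p) (g := g)).
  by move=> v; apply: betti_cone_interior facP.
move=> x [Cx tight].
have := betti_inequality_tight hW facP oz oz' z0 z0' _ Cx tight.
have le_fac j : (fac (residue p z) j <= fac (residue p z') j)%N.
  by have [->|->|->] := ordE j; rewrite ?a0 ?a1.
move=> /(_ le_fac); move: tight; rewrite !dot3 z2 z2' a0 a1 a0' a1' -/c -/c'.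
rewrite !mul0r !add0r !addr0 => e e'.
(* Cramer's rule: the third coordinate of [g] is the nonzero determinant, which fixes the scalar. *)
apply/vlineP; exists (x 0 (inord 2) / ((z (inord 0))%:R * (z' (inord 1))%:R
            - (z (inord 1))%:R * (z' (inord 0))%:R)).
apply/rowP => i; rewrite !mxE; apply: (mulIf D_neq0); rewrite mulrAC divfK //.
have [->|->|->] := ordE i; rewrite inordK //=.
- transitivity (c%:R * x 0 (inord 2) * (z' (inord 1))%:R
              - c'%:R * x 0 (inord 2) * (z (inord 1))%:R); last by ring.
  by rewrite -e -e'; ring.
- transitivity ((z (inord 0))%:R * (c'%:R * x 0 (inord 2))
              - (z' (inord 0))%:R * (c%:R * x 0 (inord 2))); last by ring.
  by rewrite -e -e'; ring.
Qed.

Theorem theorem6p4 (R : realType) (m : nat) (hm : (1 < m)%N)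
  (N : nil_op m) (hN : kunz_nilsemigroup R N)
  (p : 'I_3 -> 'Z_m) (hp : three_atoms N p) (hs : staircase N p)
  (z z' : expvec) (hzz' : z <> z')
  (hz : outer_betti N p z) (hz' : outer_betti N p z')
  (hsz : supp z = [set inord 0; inord 1]%SET) (hsz' : supp z' = [set inord 0; inord 1]%SET) :
  redundant R N p z \/ redundant R N p z'.
Proof.
(* The three atoms are distinct residues. *)
have card3 : (2 < #|'Z_m|)%N by apply: leq_trans (leq_card p hp.1); rewrite card_ord.
have [W hW NE] := kunz_nilsemigroup_weight card3 hN.
move: hs hz hz'; rewrite NE => hs hz hz'.
have [fac facP] := staircase_factorization_map hW hs.
(* The element whose factorization has the smaller third coordinate is redundant. *)
have [le|/ltnW le] := leqP (fac (residue p z) (inord 2)) (fac (residue p z') (inord 2)).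
  by left; exact: (redundant_of_factorization_le hW facP hzz' hz hz' hsz hsz' le).
by right; exact: (redundant_of_factorization_le hW facP (nesym hzz') hz' hz hsz' hsz le).
Qed.
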